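(* Let $n\ge 2$ be an integer and let $\Theta=(\theta_1,\dots,\theta_n)\in\mathbf{R}^n$ be such that $1,\theta_1,\dots,\theta_n$ are linearly independent over $\mathbf{Q}$. Then $$\frac{(\hat\omega_{n-1}(\Theta)-1)\,\omega_{n-1}(\Theta)}{((n-2)\hat\omega_{n-1}(\Theta)+1)\,\omega_{n-1}(\Theta)+(n-1)\hat\omega_{n-1}(\Theta)}\le \omega_0(\Theta)$$ and $$\omega_0(\Theta)\le \frac{(1-\hat\omega_0(\Theta))\,\omega_{n-1}(\Theta)-n+2-\hat\omega_0(\Theta)}{n-1}.$$
   Context: Definitions. $\omega_0(\Theta)$ (resp. $\omega_{n-1}(\Theta)$) is the supremum, possibly $+\infty$, of the real numbers $\omega$ for which there exist infinitely many integer $(n+1)$-tuples $(x_0,\dots,x_n)$ satisfying $$\max_{1\le i\le n}|x_0\theta_i-x_i|\le\Big(\max_{0\le i\le n}|x_i|\Big)^{-\omega}\quad\Big(\text{resp. } |x_0+x_1\theta_1+\cdots+x_n\theta_n|\le\Big(\max_{0\le i\le n}|x_i|\Big)^{-\omega}\Big).$$ $\hat\omega_0(\Theta)$ (resp. $\hat\omega_{n-1}(\Theta)$) is the supremum, possibly $+\infty$, of the real numbers $\omega$ such that for all sufficiently large real $X$ there exists a non-zero integer $(n+1)$-tuple $(x_0,\dots,x_n)$ with $\max_{0\le i\le n}|x_i|\le X$ and $$\max_{1\le i\le n}|x_0\theta_i-x_i|\le X^{-\omega}\quad\big(\text{resp. } |x_0+x_1\theta_1+\cdots+x_n\theta_n|\le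 X^{-\omega}\big).$$ Convention for infinite values. The exponents may be infinite and the inequalities are then read in the limiting sense: the left-hand side of the first inequality is read as $\dfrac{1-1/\hat\omega_{n-1}(\Theta)}{(n-2)+1/\hat\omega_{n-1}(\Theta)+(n-1)/\omega_{n-1}(\Theta)}$ with $1/\infty=0$ (and value $+\infty$ if the denominator is $0$); the second inequality is read as $\omega_{n-1}(\Theta)\ge\dfrac{(n-1)\omega_0(\Theta)+\hat\omega_0(\Theta)+n-2}{1-\hat\omega_0(\Theta)}$, the right-hand side being $+\infty$ if $\omega_0(\Theta)=+\infty$ or $\hat\omega_0(\Theta)=1$ (one always has $\hat\omega_0(\Theta)\le1$). *)

(* Defs.v *)
(* MathComp / MathComp-Analysis; the real line is an arbitrary R : realType. *)
From HB Require Import structures.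
From mathcomp Require Import all_boot all_order all_algebra.
From mathcomp Require Import all_classical all_reals all_analysis.
Set Implicit Arguments.
Unset Strict Implicit.
Unset Printing Implicit Defensive.
Import Order.TTheory GRing.Theory Num.Theory.
Import numFieldNormedType.Exports.
Local Open Scope classical_set_scope.
Local Open Scope ring_scope.

(* A point (theta_1, ..., theta_n) is a row vector theta : 'rV[R]_n, theta_(i+1)
   being theta 0 i.  An integer tuple (x_0, ..., x_n) is x : 'rV[int]_n.+1, with
   x_0 = x 0 ord0 and x_(i+1) = x 0 (lift ord0 i) for i : 'I_n. *)
Section Exponents.
Context {R : realType}.

(* Linear independence of 1, theta_1, ..., theta_n over Q.  R carries no
   rat-vector-space structure in the library, hence the explicit form. *)
Definition lin_indep_Q n (theta : 'rV[R]_n) : Prop :=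
  forall (q0 : rat) (q : 'I_n -> rat),
    ratr q0 + \sum_(i < n) ratr (q i) * theta 0 i = 0 :> R ->
    q0 = 0 /\ forall i, q i = 0.

Definition height n (x : 'rV[int]_n.+1) : R :=
  \big[Num.max/0]_(i < n.+1) `|(x 0 i)%:~R : R|.

Definition simul_err n (theta : 'rV[R]_n) (x : 'rV[int]_n.+1) : R :=
  \big[Num.max/0]_(i < n)
     `|(x 0 ord0)%:~R * theta 0 i - (x 0 (lift ord0 i))%:~R|.

Definition linear_err n (theta : 'rV[R]_n) (x : 'rV[int]_n.+1) : R :=
  `|(x 0 ord0)%:~R + \sum_(i < n) (x 0 (lift ord0 i))%:~R * theta 0 i|.

Definition ordinary_exponent n (err : 'rV[int]_n.+1 -> R) : \bar R :=
  ereal_sup [set w%:E | w in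
    [set w : R | infinite_set [set x | err x <= height x `^ (- w)]]].

Definition uniform_exponent n (err : 'rV[int]_n.+1 -> R) : \bar R :=
  ereal_sup [set w%:E | w in
    [set w : R | \forall X \near +oo, exists x : 'rV[int]_n.+1,
       [/\ x != 0, height x <= X & err x <= X `^ (- w)]]].

Definition omega_sim n (theta : 'rV[R]_n) := ordinary_exponent (simul_err theta).
Definition omega_lin n (theta : 'rV[R]_n) := ordinary_exponent (linear_err theta).
Definition uomega_sim n (theta : 'rV[R]_n) := uniform_exponent (simul_err theta).
Definition uomega_lin n (theta : 'rV[R]_n) := uniform_exponent (linear_err theta).

(* If an exponent is infinite, the bound is obtained after dividing numerator
   and denominator by uw * w.  In \bar R, +oo^-1 = 0 and 0^-1 = +oo, so this
   form is +oo when its denominator vanishes (its numerator is then 1). *)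
Definition lower_bound n (uw w : \bar R) : \bar R :=
  match uw, w with
  | a%:E, b%:E =>
      (((a - 1) * b) / (((n%:R - 2) * a + 1) * b + (n%:R - 1) * a))%:E
  | _, _ =>
      ((1 - uw^-1) / ((n%:R - 2)%:E + uw^-1 + (n%:R - 1)%:E * w^-1))%E
  end.

(* If an exponent is infinite, the inequality is solved for w, because
   (1 - uw0) * w is meaningless for uw0 = 1 and w = +oo. *)
Definition upper_inequality n (w0 uw0 w : \bar R) : Prop :=
  match w0, uw0, w with
  | a%:E, b%:E, c%:E => a <= ((1 - b) * c - n%:R + 2 - b) / (n%:R - 1)
  | _, _, _ =>
      ((if (w0 == +oo) || (uw0 == 1) then +oo
        else ((n%:R - 1)%:E * w0 + uw0 + (n%:R - 2)%:E) / (1 - uw0)) <= w)%E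
  end.

End Exponents.

(* Main.v *)
Require Import Defs.
From HB Require Import structures.
From mathcomp Require Import all_boot all_order all_algebra.
From mathcomp Require Import all_classical all_reals all_analysis.
From mathcomp Require Import ring lra zify.
Set Implicit Arguments.
Unset Strict Implicit.
Unset Printing Implicit Defensive.
Import Order.TTheory GRing.Theory Num.Theory.
Local Open Scope classical_set_scope.
Local Open Scope ring_scope.

(** Write L(x) = x_0 + sum_i x_i theta_i, and e_i(y) = y_0 theta_i - y_i.  If an
    integer point z is orthogonal to x, then z_0 L(x) = sum_i x_i e_i(z): points
    orthogonal to good approximations of one problem are good approximations of
    the other.  Both inequalities use this with two independent points, one given
    by the ordinary exponent w and the other by the uniform exponent u of the
    same problem, and a short integer point z orthogonal to both.

    From the linear form to simultaneous approximation ([linear_to_simul]), let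
    |L(x)| = l <= H^(-w) with H the height of x, and apply the uniform exponent at
    X = (l / 2)^(-1/u); this gives y of height at most X with
    |L(y)| <= l / 2.  The 2x2 minors of (x, y) are at most D = 2 H X, and the
    numbers x_k L(y) - y_k L(x), which govern the errors of z, are at most
    M = 2 X l.  A pigeonhole argument gives z with |z_0| of order D N^(n-2) and
    errors of order N^(n-2) M + 1/N ([simul_point_of_pair]); the choice
    N = M^(-1/(n-1)) makes the two terms equal, and expressing everything as a
    power of l gives the lower bound.

    From simultaneous approximation to the linear form ([simul_to_linear]), let x
    have height H and error at most H^(-w), and apply the uniform exponent just
    below H, at H / 2, to get y.  Now all the minors of (x, y) are of order
    D = H^(1-u), a pigeonhole argument on n - 1 coordinates gives z orthogonal to
    both of height of order D^(1/(n-1)) ([kernel_point_of_pair]), and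
    |L(z)| is of order height(z) H^(-w-1) because z is orthogonal to x.

    Two facts make this work.  The first is that x and y are independent: x is
    taken of minimal height among the points with an error not larger than its
    own ([minimal_points]), and a point parallel to x would have both a smaller
    height and a smaller error than x ([minimal_point_minor]).  The second is that
    being orthogonal to x and y is, once all but two coordinates of z are given, a
    congruence condition with only |minor| classes, for any nonzero minor of
    (x, y) ([kernel_classes]); it plays the part that the covolume of the
    orthogonal lattice plays in the geometry of numbers.

    The exponents being suprema, the constants in these estimates disappear
    ([ordinary_exponent_ge_family]).  What remains is an inequality for all reals
    below the exponents; it is affine in each of them, so it passes to the limit,
    finite or infinite, one variable at a time. *)

(** * Integer points orthogonal to two given ones *)

Definition minor (A : comNzRingType) (I : Type) (a b : I -> A) (k l : I) : A :=
  a k * b l - a l * b k.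

Lemma minor_opp (A : comNzRingType) (I : Type) (a b : I -> A) k l :
  minor a b l k = - minor a b k l.
Proof. by rewrite /minor opprB. Qed.

Lemma minor_eq0 (A : comNzRingType) (I : Type) (a b : I -> A) k :
  minor a b k k = 0.
Proof. by rewrite /minor subrr. Qed.

(** If z is orthogonal to a and b, it is orthogonal to b_j a - a_j b, whose
    entries are the minors [minor a b k j]; the entry at j vanishes, so z_i is a
    combination of the entries of z outside {i, j}. *)
Lemma cramer_norm_le (A : numDomainType) (I : finType) (a b z : I -> A) (i j : I) :
  \sum_k a k * z k = 0 -> \sum_k b k * z k = 0 ->
  `|z i| * `|minor a b i j| <=
    \sum_(k | (k != i) && (k != j)) `|z k| * `|minor a b k j|.
Proof.
move=> az bz.
have : \sum_k z k * minor a b k j = 0.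
  transitivity (b j * (\sum_k a k * z k) - a j * (\sum_k b k * z k)).
    rewrite !mulr_sumr -sumrB; apply: eq_bigr => k _; rewrite /minor; ring.
  by rewrite az bz !mulr0 subrr.
rewrite (bigD1 i) //= => /eqP; rewrite addr_eq0 -normrM => /eqP ->.
rewrite normrN (le_trans (ler_norm_sum _ _ _)) //.
rewrite (bigID (fun k => k == j)) /= big1 ?add0r; last first.
  by move=> k /andP[_ /eqP ->]; rewrite minor_eq0 mulr0 normr0.
by apply: ler_sum => k _; rewrite normrM.
Qed.

(** Changes the entry of s at p so that w . s becomes a remainder modulo w_p. *)
Definition reduce_at (I : finType) (w : I -> int) (p : I) (s : I -> int) : I -> int :=
  fun k => if k == p then - ((\sum_(l | l != p) w l * s l)%R %/ w p)%Z else s k.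

Lemma reduce_atE (I : finType) (w : I -> int) p s :
  \sum_k w k * reduce_at w p s k = ((\sum_(l | l != p) w l * s l)%R %% w p)%Z.
Proof.
rewrite (bigD1 p) //= {1}/reduce_at eqxx.
rewrite [X in _ + X](eq_bigr (fun l => w l * s l)); last first.
  by move=> l /negbTE lp; rewrite /reduce_at lp.
set S := \sum_(_ | _) _.
rewrite {2}(divz_eq S (w p)); ring.
Qed.

(** Hermite normal form of the two columns i and j.  With g = gcd(a_j, b_j) and
    a Bezout relation p a_j + q b_j = g, take u = p a + q b and
    v = (a_j / g) b - (b_j / g) a: this change of basis is unimodular, which keeps
    the minor and lets a and b be recovered from u and v. *)
Lemma hermite_pair (I : Type) (a b : I -> int) (i j : I) :
  minor a b i j != 0 ->
  exists u v : I -> int,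
    [/\ v j = 0, absz (v i * u j) = absz (minor a b i j) &
        exists c : int * int * int * int,
          (forall k, a k = c.1.1.1 * u k + c.1.1.2 * v k) /\
          (forall k, b k = c.1.2 * u k + c.2 * v k)].
Proof.
move=> D0; set g := gcdz (a j) (b j).
have g0 : g != 0.
  apply: contraNneq D0 => /eqP; rewrite gcdz_eq0 => /andP[/eqP aj /eqP bj].
  by rewrite /minor aj bj mulr0 mul0r subrr.
have [a1 aE] : exists a1, a j = a1 * g by apply/dvdzP; exact: dvdz_gcdl.
have [b1 bE] : exists b1, b j = b1 * g by apply/dvdzP; exact: dvdz_gcdr.
have [p [q pq]] : exists p q, p * a j + q * b j = g.
  by case: (Bezoutz (a j) (b j)) => p [q pqE]; exists p, q.
have pq1 : p * a1 + q * b1 = 1.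
  by apply: (mulIf g0); rewrite mul1r -[RHS]pq aE bE; ring.
exists (fun k => p * a k + q * b k), (fun k => a1 * b k - b1 * a k); split.
- by rewrite aE bE; ring.
- by rewrite pq -abszN /minor aE bE; congr (absz _); ring.
- exists (a1, - q, b1, p); split=> k /=.
    by rewrite -[LHS]mul1r -pq1; ring.
  by rewrite -[LHS]mul1r -pq1; ring.
Qed.

(** Adjusting s_i and then s_j turns (v . s, u . s), for the pair (u, v) in Hermite
    form, into remainders modulo v_i and u_j.  These two remainders are the class
    of s: there are |v_i u_j| = |minor a b i j| of them, and the adjusted points of
    two tuples in one class have a difference orthogonal to u and v. *)
Lemma kernel_classes (I : finType) (a b : I -> int) (i j : I) :
  minor a b i j != 0 ->
  exists (T : finType) (c : (I -> int) -> T),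
    #|T| = absz (minor a b i j) /\
    forall s t, c s = c t -> exists z : I -> int,
      [/\ forall k, k != i -> k != j -> z k = s k - t k,
          \sum_k a k * z k = 0 & \sum_k b k * z k = 0].
Proof.
move=> D0; have [u [v [vj uvE [c [aE bE]]]]] := hermite_pair D0.
have : (v i * u j != 0) by rewrite -absz_eq0 uvE absz_eq0.
rewrite mulf_eq0 negb_or => /andP[vi uj].
have ij : i != j by apply: contraNneq vi => ->; rewrite vj.
pose s1 s := reduce_at v i s.
pose s2 s := reduce_at u j (s1 s).
(* v_j = 0, so that the adjustment at j does not alter v . s *)
have vs2 s : \sum_k v k * s2 s k = ((\sum_(l | l != i) v l * s l)%R %% v i)%Z.
  rewrite -reduce_atE; apply: eq_bigr => k _; rewrite /s2 /s1 {1}/reduce_at.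
  by case: eqP => // ->; rewrite vj !mul0r.
have us2 s : \sum_k u k * s2 s k = ((\sum_(l | l != j) u l * s1 s l)%R %% u j)%Z.
  by rewrite reduce_atE.
have card_mod (d : int) : d != 0 -> #|'I_(`|d|.-1.+1)| = `|d|%N.
  by rewrite card_ord -absz_gt0; case: `|d|%N.
have mod_ord (d x y : int) : d != 0 ->
    inord `|(x %% d)%Z|%N = inord `|(y %% d)%Z|%N :> 'I_(`|d|.-1.+1) ->
    (x %% d)%Z = (y %% d)%Z.
  move=> dn0 /(congr1 val) /=.
  have lt z : (`|(z %% d)%Z| < `|d|.-1.+1)%N.
    rewrite prednK ?absz_gt0 // -ltz_nat (gez0_abs (modz_ge0 _ dn0)) ltz_mod //.
  rewrite !inordK // => e.
  by rewrite -(gez0_abs (modz_ge0 x dn0)) e gez0_abs // modz_ge0.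
exists ('I_(`|v i|.-1.+1) * 'I_(`|u j|.-1.+1))%type.
exists (fun s => (inord `|((\sum_(l | l != i) v l * s l)%R %% v i)%Z|%N,
  inord `|((\sum_(l | l != j) u l * s1 s l)%R %% u j)%Z|%N)); split.
  by rewrite card_prod !card_mod // -abszM.
move=> s t [/(mod_ord _ _ _ vi) e1 /(mod_ord _ _ _ uj) e2].
exists (fun k => s2 s k - s2 t k).
have vz : \sum_k v k * (s2 s k - s2 t k) = 0.
  by under eq_bigr do rewrite mulrBr; rewrite sumrB !vs2 e1 subrr.
have uz : \sum_k u k * (s2 s k - s2 t k) = 0.
  by under eq_bigr do rewrite mulrBr; rewrite sumrB !us2 e2 subrr.
have comb (x y : int) : \sum_k (x * u k + y * v k) * (s2 s k - s2 t k) = 0.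
  transitivity (x * (\sum_k u k * (s2 s k - s2 t k))
              + y * (\sum_k v k * (s2 s k - s2 t k))).
    rewrite !mulr_sumr -big_split; apply: eq_bigr => k _ /=; ring.
  by rewrite uz vz !mulr0 addr0.
split.
- by move=> k /negbTE ki /negbTE kj; rewrite /s2 /s1 /reduce_at kj ki.
- by under eq_bigr do rewrite aE; exact: comb.
- by under eq_bigr do rewrite bE; exact: comb.
Qed.

Lemma finite_pigeonhole (T U : finType) (f : T -> U) :
  (#|U| < #|T|)%N -> exists s t, s != t /\ f s = f t.
Proof.
move=> lt; case: (boolP (injectiveb f)) => [/injectiveP /leq_card | /injectivePn].
  by rewrite leqNgt lt.
by move=> [s [t st fst]]; exists s, t.
Qed.

Lemma card_off_pair (I : finType) (i j : I) : i != j ->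
  #|{: {k : I | (k != i) && (k != j)}}| = (#|I| - 2)%N.
Proof.
move=> ij; rewrite card_sig -(cardC (pred2 i j)).
rewrite card2 ij addKn; apply: eq_card => k.
by rewrite !inE negb_or.
Qed.

(** There are (N + 1)^(|I| - 2) tuples with entries in [0, N] outside {i, j}, more
    than there are classes.  The two remaining entries of z are controlled by
    [cramer_norm_le]. *)
Lemma small_kernel_vector (I : finType) (a b : I -> int) (i j : I) (N : nat) :
  minor a b i j != 0 -> (absz (minor a b i j) < N.+1 ^ (#|I| - 2))%N ->
  exists z : I -> int,
    [/\ exists k, z k != 0,
        forall k, k != i -> k != j -> `|z k| <= N%:Z,
        \sum_k a k * z k = 0 & \sum_k b k * z k = 0].
Proof.
move=> D0 DN; have ij : i != j.
  by apply: contraNneq D0 => ->; rewrite minor_eq0.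
have [T [c [cT cP]]] := kernel_classes D0.
pose K := {k : I | (k != i) && (k != j)}.
pose ext (f : {ffun K -> 'I_N.+1}) k : int :=
  if insub k is Some k' then (f k' : nat)%:Z else 0.
have extE f k : ext f (val k) = (f k : nat)%:Z by rewrite /ext valK.
have [|f [h [fh /cP [z [zE az bz]]]]] := @finite_pigeonhole _ _ (fun f => c (ext f)).
  by rewrite cT card_ffun card_ord card_off_pair.
exists z; split => //.
- have /existsP[k fhk] : [exists k, f k != h k].
    apply: contraNT fh => /existsPn fh; apply/eqP/ffunP => k.
    by apply/eqP; have := fh k; rewrite negbK.
  have /andP[ki kj] := valP k.
  exists (val k); rewrite zE // !extE subr_eq0 eqz_nat.
  exact: fhk.
- move=> k ki kj; have kK : (k != i) && (k != j) by rewrite ki.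
  have -> : k = val (exist _ k kK : K) by [].
  rewrite zE // !extE.
  have := ltn_ord (f (exist _ k kK)); have := ltn_ord (h (exist _ k kK)).
  move: (nat_of_ord _) (nat_of_ord _) => p q pN qN.
  rewrite ler_norml; apply/andP; split; lia.
Qed.

(** Dirichlet's box principle, with the additional requirement that the two
    multipliers s and t belong to the same class. *)
Lemma dirichlet_in_class (R : realType) (K T : finType) (theta : K -> R)
    (c : nat -> T) (N : nat) : (0 < N)%N ->
  exists s t : nat, [/\ (s < t)%N, (t <= #|T| * N ^ #|K|)%N, c s = c t &
    forall k, `|(t%:R - s%:R) * theta k
                - (Num.floor (t%:R * theta k) - Num.floor (s%:R * theta k))%:~R|
              <= N%:R^-1].
Proof.
move=> N0; set Y := (#|T| * N ^ #|K|)%N.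
pose fr (s : nat) k : R := s%:R * theta k - (Num.floor (s%:R * theta k))%:~R.
have fr0 s k : 0 <= fr s k by rewrite subr_ge0 floor_le.
have fr1 s k : fr s k < 1.
  have /andP[_] := floor_itv (s%:R * theta k); rewrite rmorphD /= => h.
  by rewrite /fr ltrBlDl.
have NR : 0 < N%:R :> R by rewrite ltr0n.
pose cell s k := Num.truncn (N%:R * fr s k).
have cellP s k : (cell s k)%:R <= N%:R * fr s k < (cell s k).+1%:R.
  by apply: truncn_itv; rewrite mulr_ge0 // ltW.
have cell_lt s k : (cell s k < N.-1.+1)%N.
  rewrite prednK // -(ltr_nat R); have /andP[/le_lt_trans -> //] := cellP s k.
  by rewrite -[ltRHS]mulr1 ltr_pM2l.
pose f (s : 'I_Y.+1) : T * {ffun K -> 'I_N.-1.+1} :=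
  (c s, [ffun k => inord (cell s k)]).
have [|s [t [st fst]]] := @finite_pigeonhole _ _ f.
  by rewrite card_prod card_ffun !card_ord prednK.
wlog lt_st : s t st fst / (s < t)%N.
  move=> H; case: (ltngtP s t) => lt; [exact: (H s t)| |].
  - by apply: (H t s) => //; rewrite eq_sym.
  - by move/val_inj/eqP: lt; rewrite (negbTE st).
exists s, t; split => //; first by rewrite -ltnS ltn_ord.
  by case: fst.
move=> k; case: fst => _ /ffunP/(_ k); rewrite !ffunE => /(congr1 val) /=.
rewrite !inordK // => e.
have -> : (t%:R - s%:R) * theta k
    - (Num.floor (t%:R * theta k) - Num.floor (s%:R * theta k))%:~R
    = fr t k - fr s k.
  by rewrite /fr rmorphB /=; ring.
rewrite -(ler_pM2l NR) divff ?gt_eqF // -{1}(ger0_norm (ltW NR)) -normrM mulrBr.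
have := cellP t k; have := cellP s k; rewrite e -natr1.
move: (N%:R * _) (N%:R * _) (cell t k)%:R => p q r /andP[h1 h2] /andP[h3 h4].
by rewrite ler_norml; apply/andP; split; lra.
Qed.

(** * Heights *)

Lemma finite_argmin (R : realType) (T : eqType) (A : set T) (f : T -> R) :
  finite_set A -> A !=set0 -> exists2 x, A x & forall y, A y -> f x <= f y.
Proof.
move=> /finite_seqP [s ->] /=; elim: s => [[x]//|x s IH] _.
have [-> | /eqP s0] := eqVneq s [::].
  by exists x; rewrite /= ?inE // => y /=; rewrite inE => /eqP ->.
have [|z zs zP] := IH; first by case: (s) s0 => // a t _; exists a; rewrite /= inE eqxx.
have [xz|zx] := leP (f x) (f z).
- exists x; rewrite /= ?inE ?eqxx // => y; rewrite inE => /orP[/eqP ->//|/zP].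
  exact: le_trans.
- exists z; rewrite /= ?inE ?zs ?orbT // => y; rewrite inE => /orP[/eqP ->|/zP //].
  exact: ltW.
Qed.

Lemma powRN_anti (R : realType) (a b v : R) :
  0 < a -> a <= b -> 0 <= v -> b `^ (- v) <= a `^ (- v).
Proof.
move=> a0 ab v0; have b0 := lt_le_trans a0 ab.
rewrite !powRN lef_pV2 ?posrE ?powR_gt0 //.
by apply: ge0_ler_powR; rewrite ?nnegrE ?(ltW a0) ?(ltW b0).
Qed.

Lemma powR_small (R : realType) (e d : R) : 0 < e -> 0 < d ->
  exists2 t0 : R, 0 < t0 & forall t, 0 < t -> t < t0 -> t `^ e < d.
Proof.
move=> e0 d0; exists (d `^ e^-1); first exact: powR_gt0.
move=> t t0 /(gt0_ltr_powR e0); rewrite !nnegrE (ltW t0) powR_ge0 => /(_ isT isT).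
by rewrite -powRrM mulVf ?gt_eqF // powRr1 // ltW.
Qed.

Section Height.
Context {R : realType} {n : nat}.
Implicit Types (x y : 'rV[int]_n.+1).
Local Notation height := (@height R n).

Lemma le_height x i : `|(x 0 i)%:~R : R| <= height x.
Proof. exact: (le_bigmax _ (fun i => `|(x 0 i)%:~R : R|)). Qed.

Lemma height_ge0 x : 0 <= height x.
Proof. exact: bigmax_ge_id. Qed.

Lemma height_le x (B : R) : 0 <= B -> (forall i, `|(x 0 i)%:~R : R| <= B) ->
  height x <= B.
Proof. by move=> B0 xB; apply: bigmax_le. Qed.

Lemma height_attained x : exists i, height x = `|(x 0 i)%:~R : R|.
Proof.
exists [arg max_(i > ord0) `|(x 0 i)%:~R : R|]%O.
by rewrite /Defs.height (bigmax_eq_arg _ ord0).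
Qed.

Lemma norm_int_ge1 (z : int) : z != 0 -> 1 <= `|z%:~R : R|.
Proof.
move=> z0; rewrite -intr_norm -[1]/(1%:~R) ler_int.
by rewrite -gtz0_ge1 normr_gt0.
Qed.

Lemma height_ge1 x : x != 0 -> 1 <= height x.
Proof.
move=> /rV0Pn [i xi]; exact: le_trans (norm_int_ge1 xi) (le_height x i).
Qed.

Lemma finite_height_le (B : R) : finite_set [set x | height x <= B].
Proof.
pose N := Num.truncn B.
pose g (f : {ffun 'I_n.+1 -> 'I_(N.*2).+1}) : 'rV[int]_n.+1 :=
  \row_i ((f i : nat)%:Z - N%:Z).
apply: (@sub_finite_set _ _ (g @` setT)); last first.
  by apply: finite_image; exact: finite_finset.
move=> x /= xB.
have xN i : `|x 0 i| <= N%:Z.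
  rewrite -ltzD1 -(ltr_int R) intr_norm (le_lt_trans (le_height x i)) //.
  by rewrite rmorphD /= (le_lt_trans xB) // natr1 truncnS_gt.
exists [ffun i => inord (absz (x 0 i + N%:Z))] => //.
apply/rowP => i; rewrite !mxE ffunE.
have /ler_normlP [h1 h2] := xN i.
rewrite inordK; first by rewrite gez0_abs; lia.
rewrite ltnS -addnn; lia.
Qed.

End Height.

(** * Exponents *)

Section Exponent.
Context {R : realType} {n : nat}.
Variable err : 'rV[int]_n.+1 -> R.
Implicit Types (x y : 'rV[int]_n.+1).
Local Notation height := (@height R n).

(** The exponents are suprema of down-closed sets, up to the zero vector, whose
    height 0 makes real powers behave differently. *)
Lemma lt_ordinary_exponent (w : R) : (w%:E < ordinary_exponent err)%E ->
  infinite_set [set x | x != 0 /\ err x <= height x `^ (- w)].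
Proof.
move=> /ereal_sup_gt [_ [v /= vinf <-]]; rewrite lte_fin => wv.
have : infinite_set ([set x | err x <= height x `^ (- v)] `\` [set 0]).
  by apply: infinite_setD.
apply: sub_infinite_set => x /= [xv /eqP x0]; split => //.
by apply: le_trans xv _; apply: ler_powR; [exact: height_ge1|lra].
Qed.

Lemma lt_uniform_exponent (w : R) : (w%:E < uniform_exponent err)%E ->
  exists X0 : R, forall X, X0 < X -> exists x,
    [/\ x != 0, height x <= X & err x <= X `^ (- w)].
Proof.
move=> /ereal_sup_gt [_ [v /= [X0 [_ X0P]] <-]]; rewrite lte_fin => wv.
exists (Num.max 1 X0) => X; rewrite gt_max => /andP[X1 /X0P [x [x0 xX xv]]].
exists x; split => //; apply: le_trans xv _.
by apply: ler_powR; [exact: ltW | lra].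
Qed.

Lemma infinite_height_gt (A : set 'rV[int]_n.+1) (B : R) :
  infinite_set A -> exists2 x, A x & B < height x.
Proof.
move=> Ainf; apply/not_exists2P => H; apply: Ainf.
apply: sub_finite_set (finite_height_le B) => x /= Ax.
by have [//|/negP] := H x; rewrite -leNgt.
Qed.

(** No point of smaller height approximates as well; when err is homogeneous,
    such a point is in particular primitive. *)
Definition minimal_point x : Prop :=
  x != 0 /\ forall y, y != 0 -> err y <= err x -> height x <= height y.

(** Replacing each witness of the exponent by a point of least height among those
    with an error not larger keeps the inequality, since the height decreases.
    The new points still have unbounded heights because their errors tend to 0
    while being nonzero. *)
Lemma minimal_points (w B : R) :
  (forall x, x != 0 -> 0 < err x) -> 0 < w -> (w%:E < ordinary_exponent err)%E ->
  exists x, [/\ minimal_point x, B < height x, B * err x < 1 &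
                err x <= height x `^ (- w)].
Proof.
move=> err0 w0 /lt_ordinary_exponent inf.
have [d d0 dP] : exists2 d : R, 0 < d &
    forall x, x != 0 -> height x <= B -> d <= err x.
  have [A0|A0] := pselect ([set x | x != 0 /\ height x <= B] !=set0).
    have [||x [x0 _] xP] := @finite_argmin R _ [set x | x != 0 /\ height x <= B] err.
    - by apply: sub_finite_set (finite_height_le B) => x /= [].
    - exact: A0.
    by exists (err x); [exact: err0 | move=> y y0 yB; exact: xP].
  by exists 1 => // x x0 xB; exfalso; apply: A0; exists x.
pose e := Num.min d (Num.max 1 B)^-1 / 2.
have e0 : 0 < e by rewrite divr_gt0 // lt_min d0 invr_gt0 lt_max ltr01.
have [z [z0 zw] zB] := infinite_height_gt (e `^ (- w^-1)) inf.
have ze : err z <= e.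
  apply: le_trans zw _.
  have H : e `^ (- w^-1) `^ (- w) = e.
    by rewrite -powRrM mulrNN mulVf ?gt_eqF // powRr1 // ltW.
  by rewrite -[leRHS]H powRN_anti ?powR_gt0 // ltW.
have [||x [x0 xz xh] xP] := @finite_argmin R _
    [set x | [/\ x != 0, err x <= err z & height x <= height z]] height.
- by apply: sub_finite_set (finite_height_le (height z)) => x /= [].
- by exists z.
have xe := le_trans xz ze.
(* the factor 1/2 in e makes both inequalities strict *)
have eB : e < d /\ B * e < 1.
  have h1 : Num.min d (Num.max 1 B)^-1 <= d by rewrite ge_min lexx.
  have h2 : Num.min d (Num.max 1 B)^-1 <= (Num.max 1 B)^-1 by rewrite ge_min lexx orbT.
  split; first by rewrite /e; lra.
  have m1 : 0 < Num.max 1 B by rewrite lt_max ltr01.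
  apply: (@le_lt_trans _ _ (Num.max 1 B * e)).
    by rewrite ler_pM2r // le_max lexx orbT.
  rewrite -(ler_pM2l m1) divff ?gt_eqF // in h2.
  rewrite /e; move: h2; set q := Num.max 1 B; set r := Num.min _ _.
  by rewrite mulrA; lra.
exists x; split.
- split => // y y0 yx; have [hy|hy] := leP (height y) (height z).
    by apply: xP; split => //; exact: le_trans yx xz.
  exact: le_trans xh (ltW hy).
- rewrite ltNge; apply/negP => /(dP _ x0) dx; lra.
- have [B0|B0] := leP B 0.
    by apply: le_lt_trans ltr01; rewrite mulr_le0_ge0 // ltW // err0.
  by apply: le_lt_trans eB.2; rewrite ler_pM2l.
- apply: le_trans xz _; apply: le_trans zw _.
  apply: powRN_anti; [exact: lt_le_trans ltr01 (height_ge1 x0) | exact: xh | exact: ltW].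
Qed.

(** If the errors tend to 0 like t^q while the heights grow at most like t^(-p),
    the exponent is at least q / p.  Stating this as q <= p c also covers p <= 0,
    where such a family cannot exist.  The proof takes v slightly larger than c:
    the gap t^(q - p v) absorbs the constant K. *)
Lemma ordinary_exponent_ge_family (K p q c : R) :
  0 < K -> 0 < q -> 0 <= c -> (ordinary_exponent err <= c%:E)%E ->
  (forall d, 0 < d -> exists t x, [/\ 0 < t, t < d, x != 0, 0 < err x &
     err x <= K * t `^ q /\ height x <= K * t `^ (- p)]) ->
  q <= p * c.
Proof.
move=> K0 q0 c0 cP fam; rewrite leNgt; apply/negP => pcq.
have [v cv [v0 eta]] : exists2 v, c < v & 0 <= v /\ 0 < q - p * v.
  pose d := (q - p * c) / (`|p| + 1).
  have p1 : 0 < `|p| + 1 by rewrite ltr_wpDl.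
  have d0 : 0 < d by rewrite divr_gt0 // subr_gt0.
  have pd : p * d < q - p * c.
    have dE : d * (`|p| + 1) = q - p * c by rewrite /d divfK // gt_eqF.
    have := ler_wpM2r (ltW d0) (ler_norm p); lra.
  by exists (c + d); [lra | split; lra].
suff inf : infinite_set [set x | err x <= height x `^ (- v)].
  have : (v%:E <= ordinary_exponent err)%E.
    by apply: le_ereal_sup_tmp; exists v%:E => //=; exists v.
  by move=> /le_trans /(_ cP); rewrite lee_fin leNgt cv.
move=> fin.
have [d d0 dP] : exists2 d : R, 0 < d &
    forall x, err x <= height x `^ (- v) -> 0 < err x -> d <= err x.
  have [A0|A0] := pselect ([set x | err x <= height x `^ (- v) /\ 0 < err x] !=set0).
    have [|x [_ x0] xP] := @finite_argmin R _ _ err _ A0.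
      by apply: sub_finite_set fin => x /= [].
    by exists (err x) => // y yv y0; exact: xP.
  by exists 1 => // x xv x0; exfalso; apply: A0; exists x.
have [t1 t10 t1P] := powR_small q0 (divr_gt0 d0 K0).
have [t2 t20 t2P] := powR_small eta (powR_gt0 (- (1 + v)) K0).
have [t [x [t0 tlt x0 ex0 [ex hx]]]] := fam (Num.min t1 t2)
  ltac:(by rewrite lt_min t10 t20).
move: tlt; rewrite lt_min => /andP[/(t1P _ t0) h1 /(t2P _ t0) h2].
have : err x < d.
  by apply: le_lt_trans ex _; rewrite mulrC -ltr_pdivlMr.
rewrite ltNge dP //; apply: le_trans ex _.
have tK : 0 < K * t `^ (- p) by rewrite mulr_gt0 // powR_gt0.
apply: (@le_trans _ _ ((K * t `^ (- p)) `^ (- v))); last first.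
  by apply: powRN_anti; [exact: lt_le_trans ltr01 (height_ge1 x0) | exact: hx |].
rewrite powRM ?powR_ge0 ?(ltW K0) // -powRrM mulrNN.
have -> : t `^ q = t `^ (q - p * v) * t `^ (p * v).
  by rewrite -powRD ?subrK // gt_eqF ?implybT.
rewrite mulrA ler_pM2r ?powR_gt0 //.
have -> : K `^ (- v) = K * K `^ (- (1 + v)).
  rewrite -[X in X * _](powRr1 (ltW K0)) -powRD ?(gt_eqF K0) ?implybT //.
  by congr (_ `^ _); lra.
by rewrite ler_pM2l // ltW.
Qed.

End Exponent.

(** * The two approximation problems *)

Lemma minor_intr (R : comNzRingType) (I : Type) (a b : I -> int) k l :
  (minor a b k l)%:~R = minor (fun k => (a k)%:~R : R) (fun k => (b k)%:~R) k l.
Proof. by rewrite /minor rmorphB !rmorphM. Qed.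

Lemma max_minor (I : finType) (a b : I -> int) :
  (exists i j, minor a b i j != 0) ->
  exists i j, minor a b i j != 0 /\
    forall k l, `|minor a b k l| <= `|minor a b i j|.
Proof.
move=> [i0 [j0 ij0]].
pose F (u : I * I) := `|minor a b u.1 u.2|.
case: (Order.TotalTheory.arg_maxP F (isT : xpredT (i0, j0))) => -[i j] _ ijP.
exists i, j; split; last by move=> k l; exact: (ijP (k, l)).
rewrite -normr_gt0; apply: lt_le_trans (ijP (i0, j0) isT).
by rewrite /F /= normr_gt0.
Qed.

Section Forms.
Context {R : realType} {n : nat}.
Implicit Types (theta : 'rV[R]_n) (x y z : 'rV[int]_n.+1).
Local Notation height := (@height R n).

Lemma heightZ (m : int) x : height (m *: x) = `|m%:~R| * height x.
Proof.
have hm : 0 <= `|m%:~R : R| * height x by rewrite mulr_ge0 ?height_ge0.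
apply/eqP; rewrite eq_le; apply/andP; split.
  apply: height_le => // i.
  by rewrite mxE rmorphM normrM ler_wpM2l ?normr_ge0 ?le_height.
have [i ->] := @height_attained R _ x.
by rewrite -normrM -rmorphM; have := @le_height R _ (m *: x) i; rewrite mxE.
Qed.

(** If all minors vanish, then y is a rational multiple of x, so that height and
    error are scaled by the same factor, which is less than 1; this contradicts
    the minimality of x. *)
Lemma minimal_point_minor (err : 'rV[int]_n.+1 -> R) x y :
  (forall (m : int) z, err (m *: z) = `|m%:~R| * err z) ->
  (forall z, z != 0 -> 0 < err z) ->
  minimal_point err x -> y != 0 ->
  (height y < height x \/ err y < err x) ->
  exists i j, minor (x 0) (y 0) i j != 0.
Proof.
move=> errZ err0 [x0 xmin] y0 yx; apply: contrapT => H.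
have m0 i j : minor (x 0) (y 0) i j = 0.
  by apply/eqP; apply: contrapT => /negP ij; apply: H; exists i, j.
have [j hx] := @height_attained R _ x.
have E : x 0 j *: y = y 0 j *: x.
  apply/rowP => i; rewrite !mxE; apply/eqP; rewrite -subr_eq0; apply/eqP.
  by rewrite -[RHS](m0 j i) /minor; ring.
have hx0 : 0 < height x := lt_le_trans ltr01 (height_ge1 x0).
have hE : height y = `|(y 0 j)%:~R|.
  apply: (mulfI (lt0r_neq0 hx0)).
  by rewrite {1}hx -heightZ E heightZ mulrC.
have eE : height x * err y = height y * err x.
  by rewrite hx hE -!errZ E.
have ex := err0 _ x0; have ey := err0 _ y0.
have [lt_h lt_e] : height y < height x /\ err y < err x.
  case: yx => lt; split=> //.
  - by rewrite -(ltr_pM2l hx0) eE ltr_pM2r.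
  - by rewrite -(ltr_pM2r ex) -eE ltr_pM2l.
by have := xmin y y0 (ltW lt_e); rewrite leNgt lt_h.
Qed.

(** [linear_err] without its absolute value: the sign matters in x_k L(y) - y_k L(x). *)
Definition linear_value theta x : R :=
  (x 0 ord0)%:~R + \sum_(i < n) (x 0 (lift ord0 i))%:~R * theta 0 i.

Lemma linear_errE theta x : linear_err theta x = `|linear_value theta x|.
Proof. by []. Qed.

Lemma linear_errZ theta (m : int) x :
  linear_err theta (m *: x) = `|m%:~R| * linear_err theta x.
Proof.
rewrite /linear_err -normrM mulrDr mulr_sumr !mxE rmorphM; congr `|_ + _|.
by apply: eq_bigr => i _; rewrite mxE rmorphM mulrA.
Qed.

Lemma le_simul_err theta x i :
  `|(x 0 ord0)%:~R * theta 0 i - (x 0 (lift ord0 i))%:~R| <= simul_err theta x.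
Proof.
exact: (le_bigmax _ (fun i => `|(x 0 ord0)%:~R * theta 0 i - (x 0 (lift ord0 i))%:~R|)).
Qed.

Lemma simul_err_ge0 theta x : 0 <= simul_err theta x.
Proof. exact: bigmax_ge_id. Qed.

Lemma simul_err_le theta x (B : R) : 0 <= B ->
  (forall i, `|(x 0 ord0)%:~R * theta 0 i - (x 0 (lift ord0 i))%:~R| <= B) ->
  simul_err theta x <= B.
Proof. by move=> B0 xB; apply: bigmax_le. Qed.

Lemma simul_errZ theta (m : int) x :
  simul_err theta (m *: x) = `|m%:~R| * simul_err theta x.
Proof.
have E i : `|((m *: x) 0 ord0)%:~R * theta 0 i - ((m *: x) 0 (lift ord0 i))%:~R|
   = `|m%:~R| * `|(x 0 ord0)%:~R * theta 0 i - (x 0 (lift ord0 i))%:~R|.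
  by rewrite -normrM !mxE !rmorphM; congr `|_|; ring.
have [-> | m0] := eqVneq m 0.
  rewrite normr0 mul0r scale0r; apply/le_anti/andP; split; last exact: simul_err_ge0.
  by apply: simul_err_le => // i; rewrite !mxE mul0r subr0 normr0.
have m0' : 0 < `|m%:~R : R| by rewrite normr_gt0 intr_eq0.
apply/le_anti/andP; split.
  apply: simul_err_le => [|i]; first by rewrite mulr_ge0 ?simul_err_ge0.
  by rewrite E ler_pM2l // le_simul_err.
rewrite mulrC -ler_pdivlMr //; apply: simul_err_le => [|i].
  by rewrite divr_ge0 ?simul_err_ge0.
by rewrite ler_pdivlMr // mulrC -E le_simul_err.
Qed.

Lemma linear_err_gt0 theta x : lin_indep_Q theta -> x != 0 ->
  0 < linear_err theta x.
Proof.
move=> ind x0; rewrite normr_gt0; apply: contraNneq x0 => E.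
have [|q0 q] := ind (x 0 ord0)%:~R (fun i => (x 0 (lift ord0 i))%:~R).
  by rewrite -[RHS]E ratr_int; congr (_ + _); apply: eq_bigr => i _; rewrite ratr_int.
apply/eqP/rowP => k; rewrite mxE; apply/eqP; rewrite -(intr_eq0 rat).
case: (unliftP ord0 k) => [i ->|->]; last exact/eqP.
by rewrite q.
Qed.

Lemma simul_err_gt0 theta x : (0 < n)%N -> lin_indep_Q theta -> x != 0 ->
  0 < simul_err theta x.
Proof.
move=> n0 ind x0; rewrite lt_def simul_err_ge0 andbT; apply: contraNneq x0 => E.
have e i : (x 0 ord0)%:~R * theta 0 i = (x 0 (lift ord0 i))%:~R.
  by apply/eqP; rewrite -subr_eq0 -normr_le0 -E le_simul_err.
have x00 : x 0 ord0 = 0.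
  pose i0 := Ordinal n0.
  have [|_ /(_ i0)] := ind (- (x 0 (lift ord0 i0))%:~R)
      (fun i => if i == i0 then (x 0 ord0)%:~R else 0).
    rewrite (bigD1 i0) //= big1 ?eqxx => [|i /negbTE ->]; last first.
      by rewrite raddf0 mul0r.
    by rewrite raddfN /= !ratr_int e addr0 addNr.
  by rewrite eqxx => /eqP; rewrite intr_eq0 => /eqP.
apply/eqP/rowP => k; rewrite mxE.
case: (unliftP ord0 k) => [i ->|->] //.
by apply/eqP; rewrite -(intr_eq0 R) -e x00 mul0r.
Qed.

(** A common upper bound of 1 and the |theta_i|, that is, of the ratios x_k / x_0
    of the points under consideration. *)
Definition theta_size theta : R := 1 + \sum_(i < n) `|theta 0 i|.

Lemma theta_size_ge1 theta : 1 <= theta_size theta.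
Proof. by rewrite lerDl sumr_ge0. Qed.

Lemma theta_size_ge theta i : `|theta 0 i| <= theta_size theta.
Proof.
rewrite /theta_size (bigD1 i) //= addrCA lerDl addr_ge0 // sumr_ge0 //.
Qed.

Lemma height_le_simul theta x :
  height x <= `|(x 0 ord0)%:~R| * theta_size theta + simul_err theta x.
Proof.
have T1 := theta_size_ge1 theta; have E0 := simul_err_ge0 theta x.
apply: height_le => [|k].
  by rewrite addr_ge0 ?mulr_ge0 // (le_trans ler01).
case: (unliftP ord0 k) => [i ->|->]; last first.
  rewrite -[leLHS]addr0 lerD // -[leLHS]mulr1 ler_wpM2l //.
have -> : (x 0 (lift ord0 i))%:~R = (x 0 ord0)%:~R * theta 0 i
   - ((x 0 ord0)%:~R * theta 0 i - (x 0 (lift ord0 i))%:~R) by ring.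
rewrite (le_trans (ler_normB _ _)) // lerD ?le_simul_err // normrM.
by rewrite ler_wpM2l // theta_size_ge.
Qed.

(** The minors that count are those avoiding the coordinate 0: the others are
    determined by them and by the numbers x_k L(y) - y_k L(x), and since these are
    less than 1 in absolute value, one of the former does not vanish.  Choose the
    largest, at (i, j), of absolute value Delta.  The box principle for theta_k
    with k outside {i, j}, with the Delta classes of [kernel_classes], gives z
    orthogonal to x and y with z_0 <= Delta N^(n-2) and small errors outside
    {i, j}.  In the coordinates (z_0, e(z)), the points x and y become
    (L(x), x_1, ..., x_n) and (L(y), y_1, ..., y_n), and [cramer_norm_le] bounds
    the two remaining errors; Delta cancels out. *)
Lemma simul_point_of_pair theta x y (M D : R) (N : nat) :
  (0 < N)%N -> M < 1 ->
  (forall k, `|(x 0 (lift ord0 k))%:~R * linear_value theta y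
             - (y 0 (lift ord0 k))%:~R * linear_value theta x| <= M) ->
  (forall k l, `|(minor (x 0) (y 0) k l)%:~R : R| <= D) ->
  (exists k l, minor (x 0) (y 0) k l != 0) ->
  exists z, [/\ z != 0, `|(z 0 ord0)%:~R| <= D * N%:R ^+ (n - 2) &
    simul_err theta z <= N%:R ^+ (n - 2) * M + n%:R / N%:R].
Proof.
move=> N0 M1 xyM xyD xy0.
pose a k := x 0 (lift ord0 k); pose b k := y 0 (lift ord0 k).
have lx : linear_value theta x = (x 0 ord0)%:~R + \sum_k (a k)%:~R * theta 0 k by [].
have ly : linear_value theta y = (y 0 ord0)%:~R + \sum_k (b k)%:~R * theta 0 k by [].
have ab0 : exists i j, minor a b i j != 0.
  apply: contrapT => H.
  have m0 i j : minor a b i j = 0.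
    by apply/eqP; apply: contrapT => /negP ij; apply: H; exists i, j.
  have m00 k : minor (x 0) (y 0) ord0 (lift ord0 k) = 0.
    have E : (a k)%:~R * linear_value theta y - (b k)%:~R * linear_value theta x
        = - (minor (x 0) (y 0) ord0 (lift ord0 k))%:~R.
      rewrite lx ly !mulrDr !mulr_sumr.
      have -> : \sum_i (a k)%:~R * ((b i)%:~R * theta 0 i)
              = \sum_i (b k)%:~R * ((a i)%:~R * theta 0 i).
        apply: eq_bigr => i _; rewrite !mulrA -!rmorphM; congr (_%:~R * _).
        by apply/eqP; rewrite -subr_eq0 -(m0 k i) /minor; apply/eqP; ring.
      by rewrite minor_intr /minor -/(a k) -/(b k); ring.
    apply/eqP; rewrite -normr_le0 -ltzD1 add0r -(ltr_int R) intr_norm -normrN -E.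
    exact: le_lt_trans (xyM k) M1.
  case: xy0 => k [l].
  case: (unliftP ord0 k) => [k' ->|->]; case: (unliftP ord0 l) => [l' ->|->].
  - by rewrite -[minor _ _ _ _]/(minor a b k' l') m0.
  - by rewrite minor_opp m00 oppr0.
  - by rewrite m00.
  - by rewrite minor_eq0.
have [i [j [ij0 ijmax]]] := max_minor ab0.
have ij : i != j by apply: contraNneq ij0 => ->; rewrite minor_eq0.
pose I := lift ord0 i; pose J := lift ord0 j.
have IJ0 : minor (x 0) (y 0) I J != 0 by [].
have [T [cl [cT clP]]] := kernel_classes IJ0.
pose K := {k : 'I_n | (k != i) && (k != j)}.
(* the tuple (s, floor (s theta_1), ..., floor (s theta_n)), whose class is used *)
pose tup (s : nat) (k : 'I_n.+1) : int :=
  if unlift ord0 k is Some k' then Num.floor (s%:R * theta 0 k') else s%:Z.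
have [s [t [st tY clst zK]]] :=
  @dirichlet_in_class R K T (fun k => theta 0 (val k)) (fun s => cl (tup s)) N N0.
have [z [zE xz yz]] := clP _ _ (esym clst).
have nI k : (lift ord0 k == I) = (k == i) by rewrite (inj_eq lift_inj).
have nJ k : (lift ord0 k == J) = (k == j) by rewrite (inj_eq lift_inj).
have z0E : z ord0 = t%:Z - s%:Z by rewrite zE // /tup unlift_none.
have z0R : (z ord0)%:~R = t%:R - s%:R :> R by rewrite z0E rmorphB.
have z00 : z ord0 != 0 by rewrite z0E subr_eq0 eqz_nat gt_eqF.
pose E (k : 'I_n.+1) : R :=
  if unlift ord0 k is Some k' then (z k)%:~R - (z ord0)%:~R * theta 0 k' else (z ord0)%:~R.
have E0 : E ord0 = (z ord0)%:~R by rewrite /E unlift_none.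
have Elift k : E (lift ord0 k) = (z (lift ord0 k))%:~R - (z ord0)%:~R * theta 0 k.
  by rewrite /E liftK.
pose form (w : 'rV[int]_n.+1) (k : 'I_n.+1) : R :=
  if unlift ord0 k is Some _ then (w 0 k)%:~R else linear_value theta w.
have form0 w : form w ord0 = linear_value theta w by rewrite /form unlift_none.
have formlift w k : form w (lift ord0 k) = (w 0 (lift ord0 k))%:~R by rewrite /form liftK.
have form_orth (w : 'rV[int]_n.+1) : \sum_k w 0 k * z k = 0 -> \sum_k form w k * E k = 0.
  move=> wz; rewrite big_ord_recl form0 E0.
  have /(congr1 (fun m : int => m%:~R : R)) := wz.
  rewrite big_ord_recl rmorphD rmorph0 rmorph_sum /= => wzR.
  rewrite -[RHS]wzR.
  rewrite /linear_value mulrDl -addrA rmorphM; congr (_ + _).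
  rewrite mulr_suml -big_split; apply: eq_bigr => k _ /=.
  by rewrite formlift Elift rmorphM; ring.
have Delta0 : 0 < `|(minor a b i j)%:~R : R| by rewrite normr_gt0 intr_eq0.
have Y_le : `|(z ord0)%:~R : R| <= `|(minor a b i j)%:~R : R| * N%:R ^+ (n - 2).
  rewrite z0R ger0_norm; last by rewrite subr_ge0 ler_nat ltnW.
  apply: (@le_trans _ _ t%:R); first by rewrite lerBlDr lerDl.
  have : (t%:R : R) <= (#|T| * N ^ #|{: K}|)%:R by rewrite ler_nat.
  rewrite card_off_pair // card_ord cT natrM natrX.
  by rewrite -[absz _]/(absz (minor a b i j)) natr_absz intr_norm.
have N0R : 0 < N%:R :> R by rewrite ltr0n.
have M0 : 0 <= M := le_trans (normr_ge0 _) (xyM i).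
have Eother k : k != i -> k != j -> `|E (lift ord0 k)| <= N%:R^-1.
  move=> ki kj; have kK : (k != i) && (k != j) by rewrite ki.
  have := zK (exist _ k kK); rewrite /= -normrN; congr (`|_| <= _).
  rewrite Elift z0R zE ?nI ?nJ // /tup !liftK; ring.
have Epivot (i' j' : 'I_n) : i' != j' ->
    (forall k, k != i' -> k != j' -> `|E (lift ord0 k)| <= N%:R^-1) ->
    `|minor a b i' j'| = `|minor a b i j| ->
    `|E (lift ord0 i')| <= N%:R ^+ (n - 2) * M + n%:R / N%:R.
  move=> ij' Eo mE.
  have mR : `|(minor a b i' j')%:~R : R| = `|(minor a b i j)%:~R : R|.
    by rewrite -!intr_norm mE.
  have formm k l : minor (form x) (form y) (lift ord0 k) (lift ord0 l)
      = (minor a b k l)%:~R by rewrite minor_intr /minor !formlift.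
  have := @cramer_norm_le _ _ (form x) (form y) E (lift ord0 i') (lift ord0 j')
    (form_orth x xz) (form_orth y yz).
  rewrite formm mR -ler_pdivlMr // => /le_trans; apply.
  rewrite ler_pdivrMr // mulrDl big_mkcond big_ord_recl /=.
  apply: lerD.
    rewrite E0 /minor !form0 !formlift mulrAC.
    apply: ler_pM => //; first by rewrite mulrC.
    have := xyM j'; rewrite -normrN; congr (`|_| <= _); ring.
  apply: (@le_trans _ _ (\sum_(k < n) N%:R^-1 * `|(minor a b i j)%:~R : R|)).
    apply: ler_sum => k _; rewrite !(inj_eq lift_inj).
    case: ifP => [/andP[ki kj]|_]; last by rewrite mulr_ge0 // invr_ge0 ltW.
    apply: ler_pM => //; first exact: Eo.
    by rewrite formm -!intr_norm ler_int ijmax.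
  by rewrite sumr_const card_ord -[leLHS]mulr_natl mulrA.
exists (\row_k z k); split.
- by apply: contraNneq z00 => /rowP /(_ ord0); rewrite !mxE => ->.
- rewrite mxE; apply: le_trans Y_le _; rewrite ler_wpM2r ?exprn_ge0 ?ler0n //.
  exact: xyD I J.
- have B0 : 0 <= N%:R ^+ (n - 2) * M :> R by rewrite mulr_ge0 ?exprn_ge0 ?ler0n.
  have B1 : 0 <= n%:R / N%:R :> R by rewrite divr_ge0 ?ler0n.
  apply: simul_err_le => [|k]; first by rewrite addr_ge0.
  rewrite !mxE -normrN opprB -Elift.
  have [-> | ki] := eqVneq k i; first exact: Epivot ij Eother erefl.
  have [-> | kj] := eqVneq k j.
    apply: (@Epivot j i); first by rewrite eq_sym.
      by move=> l lj li; exact: Eother.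
    by rewrite minor_opp normrN.
  apply: le_trans (Eother k ki kj) _; rewrite -[leLHS]add0r lerD //.
  rewrite -[leLHS]mul1r ler_wpM2r ?invr_ge0 ?ler0n // ler1n.
  exact: leq_ltn_trans (ltn_ord i).
Qed.

(** [small_kernel_vector] for the largest minor, so that the quotients of minors in
    [cramer_norm_le] are at most 1. *)
Lemma kernel_point_of_pair x y (D : R) (N : nat) :
  (forall k l, `|(minor (x 0) (y 0) k l)%:~R : R| <= D) ->
  D < N.+1%:R ^+ (n - 1) ->
  (exists k l, minor (x 0) (y 0) k l != 0) ->
  exists z, [/\ z != 0, height z <= n.+1%:R * N%:R &
    \sum_k x 0 k * z 0 k = 0].
Proof.
move=> xyD DN /max_minor [i [j [ij0 ijmax]]].
have [|z [[k0 zk0] zN xz yz]] := @small_kernel_vector _ (x 0) (y 0) i j N ij0.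
  rewrite -(ltr_nat R) natr_absz intr_norm natrX card_ord subSS.
  exact: le_lt_trans (xyD i j) DN.
have NN : N%:Z <= (n.+1)%:Z * N%:Z by rewrite -[leLHS]mul1r ler_wpM2r // lez_nat.
have pivot i' j' : (forall k, k != i' -> k != j' -> `|z k| <= N%:Z) ->
    `|minor (x 0) (y 0) i' j'| = `|minor (x 0) (y 0) i j| ->
    `|z i'| <= (n.+1)%:Z * N%:Z.
  move=> zo mE; have := cramer_norm_le i' j' xz yz.
  have m0 : 0 < `|minor (x 0) (y 0) i j| by rewrite normr_gt0.
  rewrite mE => h; rewrite -(ler_pM2r m0); apply: le_trans h _.
  rewrite big_mkcond.
  apply: (@le_trans _ _ (\sum_(k < n.+1) N%:Z * `|minor (x 0) (y 0) i j|)).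
    apply: ler_sum => k _; case: ifP => [/andP[ki kj]|_]; last by rewrite mulr_ge0.
    by apply: ler_pM => //; exact: zo.
  by rewrite sumr_const card_ord -[leLHS]mulr_natl mulrA natz.
exists (\row_k z k); split.
- by apply: contraNneq zk0 => /rowP /(_ k0); rewrite !mxE => ->.
- apply: height_le => [|k]; first by rewrite mulr_ge0.
  have -> : n.+1%:R * N%:R = (n.+1%:Z * N%:Z)%:~R :> R by rewrite rmorphM.
  rewrite mxE -intr_norm ler_int.
  have [-> | ki] := eqVneq k i; first exact: pivot zN erefl.
  have [-> | kj] := eqVneq k j.
    apply: (pivot j i) => [l lj li|]; first exact: zN.
    by rewrite minor_opp normrN.
  exact: le_trans (zN k ki kj) NN.
- by rewrite -[RHS]xz; apply: eq_bigr => k _; rewrite mxE.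
Qed.

(** Orthogonality reads x_0 L(z) = sum_k z_k e_k(x). *)
Lemma linear_err_orthogonal theta x z : \sum_k x 0 k * z 0 k = 0 ->
  `|(x 0 ord0)%:~R| * linear_err theta z <= n%:R * height z * simul_err theta x.
Proof.
move=> xz.
have /(congr1 (fun m : int => m%:~R : R)) := xz.
rewrite big_ord_recl rmorphD rmorph0 rmorph_sum /= => xzR.
have E : (x 0 ord0)%:~R * linear_value theta z = \sum_(k < n)
   (z 0 (lift ord0 k))%:~R * ((x 0 ord0)%:~R * theta 0 k - (x 0 (lift ord0 k))%:~R).
  rewrite -[LHS]subr0 -[X in _ - X]xzR rmorphM mulrDr opprD addrACA subrr add0r.
  rewrite mulr_sumr -sumrB; apply: eq_bigr => k _.
  by rewrite rmorphM; ring.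
rewrite linear_errE -normrM E (le_trans (ler_norm_sum _ _ _)) //.
apply: (@le_trans _ _ (\sum_(k < n) height z * simul_err theta x)).
  apply: ler_sum => k _; rewrite normrM; apply: ler_pM => //.
    exact: le_height.
  exact: le_simul_err.
by rewrite sumr_const card_ord -[leLHS]mulr_natl mulrA.
Qed.

Lemma minor_le_linear x y k l :
  `|(minor (x 0) (y 0) k l)%:~R : R| <= 2 * (height x * height y).
Proof.
rewrite minor_intr /minor (le_trans (ler_normB _ _)) // !normrM mulr2n mulrDl mul1r.
by apply: lerD; apply: ler_pM => //; exact: le_height.
Qed.

(** With theta_0 = 1 and e_0 = 0, substituting x_k = x_0 theta_k - e_k(x) cancels the
    main terms of the minor. *)
Lemma minor_le_simul theta x y k l :
  `|(minor (x 0) (y 0) k l)%:~R : R| <= 2 * theta_size theta *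
     (height x * simul_err theta y + height y * simul_err theta x).
Proof.
pose th (k : 'I_n.+1) : R := if unlift ord0 k is Some k' then theta 0 k' else 1.
pose e (w : 'rV[int]_n.+1) k : R := (w 0 ord0)%:~R * th k - (w 0 k)%:~R.
have th_le m : `|th m| <= theta_size theta.
  rewrite /th; case: unliftP => [m' _|_]; first exact: theta_size_ge.
  by rewrite normr1 theta_size_ge1.
have e_le w m : `|e w m| <= simul_err theta w.
  rewrite /e /th; case: unliftP => [m' ->|->]; first exact: le_simul_err.
  by rewrite mulr1 subrr normr0 simul_err_ge0.
have -> : (minor (x 0) (y 0) k l)%:~R =
    ((x 0 ord0)%:~R * th l * e y k - (x 0 ord0)%:~R * th k * e y l)
    + ((y 0 k)%:~R * e x l - (y 0 l)%:~R * e x k).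
  by rewrite minor_intr /minor /e; ring.
have T1 := theta_size_ge1 theta.
set T := theta_size theta in th_le T1 *.
have bx m m' : `|(x 0 ord0)%:~R * th m * e y m'| <= height x * T * simul_err theta y.
  by rewrite !normrM; apply: ler_pM => //; apply: ler_pM => //; exact: le_height.
have hy0 := @height_ge0 R _ y; have ex0 := simul_err_ge0 theta x.
have by_ m m' : `|(y 0 m)%:~R * e x m'| <= T * (height y * simul_err theta x).
  rewrite normrM (@le_trans _ _ (1 * (height y * simul_err theta x))) //.
    by rewrite mul1r; apply: ler_pM => //; exact: le_height.
  by rewrite ler_wpM2r // mulr_ge0.
apply: le_trans (ler_normD _ _) _.
have h1 := le_trans (ler_normB ((x 0 ord0)%:~R * th l * e y k)
  ((x 0 ord0)%:~R * th k * e y l)) (lerD (bx l k) (bx k l)).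
have h2 := le_trans (ler_normB ((y 0 k)%:~R * e x l)
  ((y 0 l)%:~R * e x k)) (lerD (by_ k l) (by_ l k)).
apply: le_trans (lerD h1 h2) _; rewrite le_eqVlt; apply/orP; left; apply/eqP; ring.
Qed.

End Forms.

(** * The two transfer inequalities below the exponents *)

Lemma powR_add (R : realType) (t r s : R) : 0 < t ->
  t `^ (r + s) = t `^ r * t `^ s.
Proof. by move=> t0; rewrite powRD // (gt_eqF t0) implybT. Qed.

Lemma powR_exprn (R : realType) (t r : R) (k : nat) :
  (t `^ r) ^+ k = t `^ (k%:R * r).
Proof. by rewrite -powR_mulrn ?powR_ge0 // -powRrM mulrC. Qed.

Section Transfer.
Context {R : realType}.

Local Notation height := (@Defs.height R _).

(** The dimension is n = m + 2.  All quantities are powers of l = |L(x)|, with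
    q = (1 - 1/a) / (n - 1): the error of the new point is of order l^q and its
    height of order l^(-p), where p = 1/b + 1/a + (n - 2) q. *)
Lemma linear_to_simul m (theta : 'rV[R]_m.+2) (a b c : R) :
  lin_indep_Q theta -> 1 < a -> 0 < b -> 0 <= c ->
  (a%:E < uomega_lin theta)%E -> (b%:E < omega_lin theta)%E ->
  (omega_sim theta <= c%:E)%E ->
  (a - 1) * b <= c * ((m%:R * a + 1) * b + m.+1%:R * a).
Proof.
move=> ind a1 b0 c0 /lt_uniform_exponent [X0 X0P] bw cw.
have a0 : 0 < a by lra.
have ia0 : 0 < a^-1 by rewrite invr_gt0.
have ia1 : a^-1 < 1 by rewrite invf_lt1.
have m0 : 0 < m.+1%:R :> R by rewrite ltr0n.
pose q := (1 - a^-1) / m.+1%:R.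
pose p := b^-1 + a^-1 + m%:R * q.
have q0 : 0 < q by rewrite divr_gt0 // subr_gt0.
have qE : m.+1%:R * q = 1 - a^-1 by rewrite mulrC divfK // gt_eqF.
have p0 : 0 < p.
  rewrite /p ltr_pwDl //; first by rewrite addr_gt0 // invr_gt0.
  by rewrite mulr_ge0 ?ler0n // ltW.
pose T := theta_size theta; have T1 : 1 <= T := theta_size_ge1 theta.
pose K1 : R := 2 ^+ m.+2 + m.+2%:R.
have K10 : 0 < K1 by rewrite addr_gt0 ?exprn_gt0 ?ltr0n.
suff key : q <= p * c.
  have E1 : (a - 1) * b = m.+1%:R * q * (a * b).
    by rewrite qE; field; rewrite gt_eqF.
  have E2 : (m%:R * a + 1) * b + m.+1%:R * a = m.+1%:R * p * (a * b).
    rewrite /p 2!mulrDr [m.+1%:R * (m%:R * q)]mulrCA qE -natr1; field.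
    by rewrite !gt_eqF.
  rewrite E1 E2 [leRHS](_ : _ = m.+1%:R * (p * c) * (a * b)); last by ring.
  by apply: ler_wpM2r; [rewrite mulr_ge0 // ltW | rewrite ler_wpM2l // ltW].
apply: (@ordinary_exponent_ge_family _ _ (simul_err theta) (K1 * (T + 1)) _ _ _ _ q0 c0 cw).
  by rewrite mulr_gt0 // addr_gt0 // (lt_le_trans ltr01).
move=> d d0.
have [t1 t10 t1P] := @powR_small R a^-1 (Num.max 1 X0)^-1 ia0
  ltac:(by rewrite invr_gt0 lt_max ltr01).
have [t2 t20 t2P] := @powR_small R (1 - a^-1) 4^-1
  ltac:(by rewrite subr_gt0) ltac:(by rewrite invr_gt0 ltr0n).
pose t0 := Num.min (Num.min 1 d) (Num.min t1 t2).
have t00 : 0 < t0 by rewrite !lt_min ltr01 d0 t10.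
have [x [xmin xB xt xw]] := minimal_points t0^-1 (fun x => linear_err_gt0 ind) b0 bw.
have x0 := xmin.1.
pose L := linear_err theta x; have L0 : 0 < L := linear_err_gt0 ind x0.
have : L < t0 by rewrite -(@ltr_pM2l _ t0^-1) ?invr_gt0 // mulVf ?gt_eqF.
rewrite !lt_min => /andP[/andP[L1 Ld] /andP[Lt1 Lt2]].
have L20 : 0 < L / 2 by rewrite divr_gt0.
(* chosen so that X^(-a) = L / 2, which forces the error of y below that of x *)
pose X := (L / 2) `^ (- a^-1).
have XX0 : X0 < X.
  have : (L / 2) `^ a^-1 < (Num.max 1 X0)^-1 by apply: t1P => //; lra.
  have mx : 0 < Num.max 1 X0 by rewrite lt_max ltr01.
  rewrite /X powRN -{1}[Num.max _ _]invrK invrK => h.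
  apply: (@le_lt_trans _ _ (Num.max 1 X0)); first by rewrite le_max lexx orbT.
  by rewrite -[ltLHS]invrK ltf_pV2 ?posrE ?powR_gt0 // invr_gt0.
have [y [y0 yX yL]] := X0P _ XX0.
have X_a : X `^ (- a) = L / 2.
  by rewrite -powRrM mulrNN mulVf ?gt_eqF // powRr1 // ltW.
rewrite X_a in yL.
have yx : linear_err theta y < L by lra.
have XL : X <= 2 * L `^ (- a^-1).
  rewrite /X powRM ?invr_ge0 ?(ltW L0) // mulrC ler_wpM2r ?powR_ge0 //.
  rewrite -powR_inv1 // -powRrM mulN1r opprK -[leRHS]powRr1 //.
  by rewrite ler_powR // ?ler1n // ltW.
have hxX : height x <= X := le_trans (xmin.2 y y0 (ltW yx)) yX.
have X0' : 0 < X by apply: powR_gt0.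
have hxL : height x <= L `^ (- b^-1).
  have hx := lt_le_trans ltr01 (@height_ge1 R _ x x0).
  have ib : 0 <= b^-1 by rewrite invr_ge0 ltW.
  have := powRN_anti L0 xw ib.
  by rewrite -powRrM mulrNN mulfV ?gt_eqF // powRr1 // ltW.
pose M := 4 * L `^ (1 - a^-1).
have ME : 2 * (2 * L `^ (- a^-1)) * L = M.
  by rewrite /M powR_add // powRr1 ?(ltW L0) //; ring.
have M1 : M < 1.
  by have := t2P L L0 Lt2; rewrite /M; lra.
(* M is of order L^((n-1) q), so that N^(n-2) M and 1/N are both of order L^q *)
pose N := (Num.truncn (L `^ (- q))).+1.
have LN : L `^ (- q) < N%:R := truncnS_gt _.
have Lq1 : L `^ q <= 1.
  by rewrite -(powRr0 L) ger_powR ?L0 ?ltW.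
have L1N s : 0 <= s -> 1 <= L `^ (- s).
  by move=> s0; rewrite -[leLHS](powRr0 L) ger_powR ?L0 ?(ltW L1) // oppr_le0.
have NL : N%:R <= 2 * L `^ (- q).
  have := L1N _ (ltW q0).
  have /andP[] := @truncn_itv R (L `^ (- q)) (powR_ge0 _ _).
  by rewrite /N -natr1; lra.
have N0 : 0 < N%:R :> R by rewrite ltr0n.
have NV : N%:R^-1 <= L `^ q.
  rewrite -[leRHS]invrK -powRN lef_pV2 ?posrE ?powR_gt0 //; exact: ltW.
have NmL : N%:R ^+ m <= 2 ^+ m * L `^ (- (m%:R * q)).
  rewrite -mulrN -powR_exprn -exprMn; apply: lerXn2r => //.
    by rewrite nnegrE ltW.
  by rewrite nnegrE mulr_ge0 // powR_ge0.
pose D := 4 * L `^ (- b^-1 - a^-1).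
have [|k l||z [z0 zY zE]] := @simul_point_of_pair _ _ theta x y M D N isT M1.
- move=> k; apply: le_trans (ler_normB _ _) _; rewrite !normrM -!linear_errE.
  have hxk := @le_height R _ x (lift ord0 k).
  have hyk := le_trans (@le_height R _ y (lift ord0 k)) yX.
  have h1 : `|(x 0 (lift ord0 k))%:~R| * linear_err theta y <= X * L.
    by apply: ler_pM; [| rewrite linear_errE | exact: le_trans hxk hxX | exact: ltW].
  have h2 : `|(y 0 (lift ord0 k))%:~R| * linear_err theta x <= X * L.
    by apply: ler_pM => //; exact: ltW.
  apply: le_trans (lerD h1 h2) _; rewrite -ME.
  by have := ler_wpM2r (ltW L0) XL; lra.
- apply: le_trans (minor_le_linear _ _ _ _) _.
  have : height x * height y <= L `^ (- b^-1) * (2 * L `^ (- a^-1)).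
    apply: ler_pM => //; [exact: height_ge0|exact: height_ge0|exact: le_trans yX XL].
  by rewrite /D powR_add //; lra.
- apply: (minimal_point_minor (linear_errZ theta) _ xmin y0 (or_intror yx)).
  by move=> w; exact: linear_err_gt0.
have zE' : simul_err theta z <= K1 * L `^ q.
  apply: le_trans zE _; rewrite subSS subSS subn0 /K1 [leRHS]mulrDl; apply: lerD; last first.
    by rewrite ler_wpM2l // ler0n.
  have -> : 2 ^+ m.+2 * L `^ q = 2 ^+ m * L `^ (- (m%:R * q)) * M.
    have -> : q = - (m%:R * q) + (1 - a^-1) by rewrite -qE -natr1; ring.
    rewrite powR_add // /M !exprS.
    have -> : - (m%:R * (- (m%:R * q) + (1 - a^-1))) = - (m%:R * q).
      by rewrite -qE -natr1; ring.
    ring.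
  rewrite ler_wpM2r // /M mulr_ge0 ?powR_ge0 //.
exists L, z; split => //.
  exact: simul_err_gt0 (ltn0Sn _) _ _.
have LLp := L1N _ (ltW p0).
have K11 : K1 * L `^ q <= K1 * L `^ (- p).
  by rewrite ler_pM2l // (le_trans Lq1).
split.
  apply: le_trans zE' _; rewrite mulrAC [leRHS]mulrDr mulr1 lerDr.
  by rewrite !mulr_ge0 ?powR_ge0 ?(ltW K10) // (le_trans ler01).
apply: le_trans (height_le_simul theta z) _.
rewrite [leRHS](_ : _ = K1 * L `^ (- p) * T + K1 * L `^ (- p)); last by ring.
apply: lerD; last exact: le_trans zE' K11.
rewrite -/T ler_wpM2r ?(le_trans ler01) //.
apply: le_trans zY _; rewrite subSS subSS subn0.
apply: (@le_trans _ _ (2 ^+ m.+2 * L `^ (- p))).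
  have -> : - p = (- b^-1 - a^-1) + - (m%:R * q) by rewrite /p; ring.
  have -> : 2 ^+ m.+2 * L `^ (- b^-1 - a^-1 + - (m%:R * q))
     = D * (2 ^+ m * L `^ (- (m%:R * q))).
    by rewrite powR_add // /D !exprS; ring.
  by rewrite ler_wpM2l // mulr_ge0 ?powR_ge0.
by rewrite /K1 ler_wpM2r ?powR_ge0 // lerDl ler0n.
Qed.

(** Here t = 1/H, the new point has height of order H^p with p = (1 - b) / (n - 1)
    and error of order H^(p - 1 - a).  For 1 + a <= p this error does not
    tend to 0, but then the inequality holds as c >= 0. *)
Lemma simul_to_linear m (theta : 'rV[R]_m.+2) (a b c : R) :
  lin_indep_Q theta -> 0 < a -> 0 <= c ->
  (a%:E < omega_sim theta)%E -> (b%:E < uomega_sim theta)%E ->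
  (omega_lin theta <= c%:E)%E ->
  m.+1%:R * (1 + a) <= (1 - b) * (c + 1).
Proof.
move=> ind a0 c0 aw /lt_uniform_exponent [X0 X0P] cw.
have m0 : 0 < m.+1%:R :> R by rewrite ltr0n.
pose p := (1 - b) / m.+1%:R.
have pE : 1 - b = m.+1%:R * p by rewrite mulrC divfK // gt_eqF.
rewrite pE -mulrA ler_pM2l //.
have [q0|q0] := leP (1 + a - p) 0.
  have : 0 <= p * c by rewrite mulr_ge0 //; lra.
  lra.
suff : 1 + a - p <= p * c by lra.
pose T := theta_size theta; have T1 : 1 <= T := theta_size_ge1 theta.
have T0 : 0 < T := lt_le_trans ltr01 T1.
pose cb : R := (2^-1) `^ (- b).
have cb0 : 0 < cb by rewrite powR_gt0 // invr_gt0.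
pose K1 : R := m.+3%:R * (4 * T * cb) `^ (m.+1%:R^-1).
have K10 : 0 < K1 by rewrite mulr_gt0 ?ltr0n // powR_gt0 // !mulr_gt0.
pose K2 : R := 2 * T * m.+2%:R.
have K20 : 0 < K2 by rewrite !mulr_gt0 // ltr0n.
apply: (@ordinary_exponent_ge_family _ _ (linear_err theta) (K1 * (1 + K2)) _ _ _ _ q0 c0 cw).
  by rewrite mulr_gt0 // addr_gt0.
move=> d d0.
have [x [xmin xB xt xw]] := minimal_points (Num.max 2 (Num.max (2 * X0) d^-1))
  (fun x => simul_err_gt0 (isT : (0 < m.+2)%N) ind) a0 aw.
have x0 := xmin.1.
move: xB; rewrite !gt_max => /andP[xB2 /andP[xBX xBd]].
pose E := simul_err theta x; have E0 : 0 < E := simul_err_gt0 (ltn0Sn _) ind x0.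
have E2 : 2 * E < 1.
  by apply: le_lt_trans xt; rewrite ler_pM2r // le_max lexx.
pose H : R := height x; have H0 : 0 < H by rewrite (lt_trans _ xB2).
have XX0 : X0 < H / 2 by rewrite /H; lra.
have [y [y0 yH yE]] := X0P _ XX0.
have yE' : simul_err theta y <= cb * H `^ (- b).
  by apply: le_trans yE _; rewrite powRM ?invr_ge0 ?(ltW H0) // mulrC.
have yx : height y < height x by rewrite -/H; lra.
(* by minimality, the uniform point, of smaller height, has the larger error *)
have Exy : E < simul_err theta y.
  by rewrite ltNge; apply/negP => /(xmin.2 y y0); rewrite leNgt yx.
pose D := 4 * T * cb * H `^ (1 - b).
have D0 : 0 < D by rewrite !mulr_gt0 // powR_gt0.
have HHb : H * H `^ (- b) = H `^ (1 - b) by rewrite powR_add // powRr1 // ltW.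
pose r := D `^ (m.+1%:R^-1); have r0 : 0 <= r := powR_ge0 _ _.
pose N := Num.truncn r.
have /andP[Nr rN] := truncn_itv r0; rewrite -/N in Nr rN.
have [|||z [z0 zH xz]] := @kernel_point_of_pair R _ x y D N.
- move=> k l; apply: le_trans (minor_le_simul theta x y k l) _.
  have h1 : height y * simul_err theta x <= H * simul_err theta y.
    by apply: ler_pM; rewrite ?height_ge0 ?simul_err_ge0 // ltW.
  have h2 : H * simul_err theta y <= H * (cb * H `^ (- b)) by rewrite ler_wpM2l // ltW.
  have -> : D = 2 * T * (H * (cb * H `^ (- b)) + H * (cb * H `^ (- b))).
    by rewrite /D -HHb; ring.
  by rewrite ler_wpM2l ?mulr_ge0 ?(ltW T0) // lerD // (le_trans h1).
- rewrite subSS subn0.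
  have -> : D = r ^+ m.+1.
    by rewrite powR_exprn mulfV ?gt_eqF // powRr1 // ltW.
  by rewrite ltrXn2r // nnegrE.
- apply: (minimal_point_minor (simul_errZ theta) _ xmin y0 (or_introl yx)).
  by move=> w; exact: simul_err_gt0 (ltn0Sn _) ind.
have zK : height z <= K1 * H `^ p.
  apply: le_trans zH _; rewrite /K1 -mulrA ler_wpM2l // (le_trans Nr) //.
  by rewrite /r /D powRM ?powR_ge0 ?(ltW (mulr_gt0 _ cb0)) ?mulr_gt0 // -powRrM.
have tE s : (H^-1) `^ s = H `^ (- s).
  by rewrite -powR_inv1 ?(ltW H0) // -powRrM mulN1r.
exists H^-1, z; split => //.
- by rewrite invr_gt0.
- by rewrite -[ltRHS]invrK ltf_pV2 ?posrE // invr_gt0.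
- exact: linear_err_gt0.
rewrite !tE opprK; split; last first.
  apply: le_trans zK _; rewrite ler_wpM2r ?powR_ge0 // -[leLHS]mulr1.
  by rewrite ler_pM2l // lerDl ltW.
have x0T : H <= 2 * T * `|(x 0 ord0)%:~R|.
  by have := height_le_simul theta x; rewrite -/E -/H -/T; rewrite -/H in xB2; lra.
have orth := linear_err_orthogonal theta xz.
have L0 : 0 <= linear_err theta z by rewrite linear_errE.
have HL : H * linear_err theta z <= K2 * (K1 * H `^ p * H `^ (- a)).
  apply: le_trans (ler_wpM2r L0 x0T) _.
  rewrite /K2 -[leLHS]mulrA -[leRHS]mulrA ler_wpM2l ?mulr_ge0 ?(ltW T0) //.
  apply: le_trans orth _; rewrite -mulrA ler_wpM2l //.
  by apply: ler_pM => //; [exact: height_ge0 | exact: simul_err_ge0].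
have : linear_err theta z <= K2 * K1 * H `^ (- (1 + a - p)).
  rewrite -(ler_pM2l H0); apply: le_trans HL _; rewrite le_eqVlt; apply/orP; left.
  have -> : - (1 + a - p) = -1 + p + - a by ring.
  rewrite !powR_add // powR_inv1 ?(ltW H0) //.
  by apply/eqP; field; rewrite gt_eqF.
move/le_trans; apply; rewrite ler_wpM2r ?powR_ge0 // mulrC ler_pM2l //.
by rewrite lerDr.
Qed.

(** Dirichlet's theorem gives exponent at least 1/n; with c = 0 it contradicts
    [ordinary_exponent_ge_family]. *)
Lemma omega_sim_gt0 m (theta : 'rV[R]_m.+1) :
  lin_indep_Q theta -> (0 < omega_sim theta)%E.
Proof.
move=> ind; rewrite ltNge; apply/negP => w0.
suff : (1 : R) <= m.+1%:R * 0 by rewrite mulr0 ler10.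
pose T := theta_size theta; have T1 : 1 <= T := theta_size_ge1 theta.
apply: (@ordinary_exponent_ge_family _ _ (simul_err theta) (T + 1) _ _ _ _ ltr01 (lexx 0) w0).
  by rewrite addr_gt0 // (lt_le_trans ltr01).
move=> d d0; pose N := (Num.truncn d^-1).+1.
have dN : d^-1 < N%:R := truncnS_gt _.
have N1 : 1 <= N%:R :> R by rewrite ler1n.
have N0 : 0 < N%:R :> R := lt_le_trans ltr01 N1.
have [s [t [st tN _ H]]] :=
  @dirichlet_in_class R 'I_m.+1 unit (theta 0) (fun=> tt) N isT.
pose z : 'rV[int]_m.+2 := \row_k
  if unlift ord0 k is Some i then Num.floor (t%:R * theta 0 i) - Num.floor (s%:R * theta 0 i)
  else t%:Z - s%:Z.
have z00 : z 0 ord0 = t%:Z - s%:Z by rewrite mxE unlift_none.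
have zi i : z 0 (lift ord0 i) = Num.floor (t%:R * theta 0 i) - Num.floor (s%:R * theta 0 i).
  by rewrite mxE liftK.
have zR : (z 0 ord0)%:~R = t%:R - s%:R :> R by rewrite z00 rmorphB.
have z0 : z != 0.
  apply: contraTneq st => zz; move/eqP: z00.
  by rewrite zz mxE eq_sym subr_eq0 eqz_nat => /eqP ->; rewrite ltnn.
have zE : simul_err theta z <= N%:R^-1.
  apply: simul_err_le => [|i]; first by rewrite invr_ge0 ltW.
  by rewrite zi zR; exact: H.
exists N%:R^-1, z; split => //.
- by rewrite invr_gt0.
- by rewrite -[ltRHS]invrK ltf_pV2 ?posrE // invr_gt0.
- exact: simul_err_gt0 (ltn0Sn _) _ _.
have V1 : N%:R^-1 <= 1 :> R by rewrite invf_le1.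
split.
  rewrite powRr1 ?invr_ge0 ?(ltW N0) //; apply: le_trans zE _.
  by rewrite -[leLHS]mul1r ler_wpM2r ?invr_ge0 ?(ltW N0) //; lra.
rewrite powRN powR_mulrn ?invr_ge0 ?(ltW N0) // exprVn invrK.
have NX : 1 <= N%:R ^+ m.+1 :> R by apply: exprn_ege1.
apply: le_trans (height_le_simul theta z) _; rewrite mulrDl mul1r; apply: lerD.
  rewrite mulrC ler_wpM2l ?(le_trans ler01) // zR ger0_norm.
    apply: (@le_trans _ _ t%:R); first by rewrite lerBlDr lerDl.
    move: tN; rewrite card_unit mul1n card_ord.
    by rewrite -(ler_nat R) natrX.
  by rewrite subr_ge0 ler_nat ltnW.
exact: le_trans zE (le_trans V1 NX).
Qed.

(** The point (1, 0, ..., 0) has error 1. *)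
Lemma uomega_lin_ge0 m (theta : 'rV[R]_m.+1) : (0 <= uomega_lin theta)%E.
Proof.
apply: le_ereal_sup_tmp; exists 0%:E => //; exists 0 => //=.
exists 1; split; first exact: real1.
move=> X /ltW X1; exists (\row_k (k == ord0)%:R); split.
- by apply/rV0Pn; exists ord0; rewrite mxE.
- apply: height_le => [|k]; first exact: le_trans ler01 X1.
  by rewrite mxE; apply: le_trans X1; case: eqP; rewrite ?normr1 ?normr0.
- rewrite oppr0 powRr0 /linear_err mxE eqxx big1 ?addr0 ?normr1 // => i _.
  by rewrite mxE mul0r.
Qed.

(** The point (0, 1, ..., 1) has error 1. *)
Lemma uomega_sim_ge0 m (theta : 'rV[R]_m.+1) : (0 <= uomega_sim theta)%E.
Proof.
apply: le_ereal_sup_tmp; exists 0%:E => //; exists 0 => //=.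
exists 1; split; first exact: real1.
move=> X /ltW X1; exists (\row_k (k != ord0)%:R); split.
- by apply/rV0Pn; exists (lift ord0 ord0); rewrite mxE.
- apply: height_le => [|k]; first exact: le_trans ler01 X1.
  by rewrite mxE; apply: le_trans X1; case: eqP; rewrite ?normr1 ?normr0.
- rewrite oppr0 powRr0; apply: simul_err_le => // i.
  by rewrite !mxE eqxx mul0r sub0r normrN normr1.
Qed.

(** The points (- floor (k theta_1), k, 0, ..., 0) have error at most 1. *)
Lemma omega_lin_ge0 m (theta : 'rV[R]_m.+1) : (0 <= omega_lin theta)%E.
Proof.
apply: le_ereal_sup_tmp; exists 0%:E => //; exists 0 => //= fin.
pose g (k : nat) : 'rV[int]_m.+2 := \row_l
  if l == ord0 then - Num.floor (k%:R * theta 0 ord0)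
  else if l == lift ord0 ord0 then k%:Z else 0.
have gA k : linear_err theta (g k) <= height (g k) `^ (- 0).
  rewrite oppr0 powRr0 /linear_err big_ord_recl big1 => [|i _]; last first.
    by rewrite !mxE /= mul0r.
  rewrite !mxE /= addr0 rmorphN /= addrC.
  have /andP[h1 h2] := floor_itv (k%:R * theta 0 ord0).
  by rewrite rmorphD /= in h2; rewrite ler_norml; apply/andP; split; lra.
have [|x _ xP] := finite_argmin (fun x => - height x) fin.
  by exists (g 0%N); exact: gA.
have := xP _ (gA (Num.truncn (height x)).+1); rewrite lerN2 leNgt => /negP; apply.
apply: lt_le_trans (truncnS_gt _) _.
set k := (Num.truncn _).+1; have := @le_height R _ (g k) (lift ord0 ord0).
by rewrite mxE /= normr_nat.
Qed.

End Transfer.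

(** * Passing to the exponents *)

Lemma affine_le0_at_end (R : realType) (u v lo a : R) : lo < a ->
  (forall x, lo < x -> x < a -> u + v * x <= 0) -> u + v * a <= 0.
Proof.
move=> lo_a H; rewrite leNgt; apply/negP => e0; set e := u + v * a in e0.
have v1 : 0 < `|v| + 1 by rewrite ltr_wpDl.
pose s := Num.min ((a - lo) / 2) (e / (`|v| + 1)).
have s0 : 0 < s.
  by rewrite lt_min !divr_gt0 // subr_gt0.
have s1 : s <= (a - lo) / 2 by rewrite ge_min lexx.
have s2 : (`|v| + 1) * s <= e.
  by rewrite mulrC -ler_pdivlMr // ge_min lexx orbT.
have vs := ler_wpM2r (ltW s0) (ler_norm v).
have : u + v * (a - s) <= 0 by apply: H; lra.
rewrite /e in s2; lra.
Qed.

Lemma affine_le0_at_infty (R : realType) (u v lo : R) :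
  (forall x, lo < x -> u + v * x <= 0) -> v <= 0.
Proof.
move=> H; rewrite leNgt; apply/negP => v0.
pose x := Num.max (lo + 1) ((1 - u) / v).
have x1 : lo < x by rewrite lt_max ltrDl ltr01.
have : v * ((1 - u) / v) <= v * x by rewrite ler_pM2l // le_max lexx orbT.
rewrite mulrC divfK ?gt_eqF //; have := H x x1; lra.
Qed.

(** The hypothesis is affine in a and in b: a finite exponent is reached by
    [affine_le0_at_end], and an infinite one leaves only the leading coefficient,
    by [affine_le0_at_infty].  For U <= 1 or W = 0, where the hypothesis is empty,
    the lower bound is at most 0. *)
Lemma lower_bound_le (R : realType) (m : nat) (U W : \bar R) (c : R) :
  (0 <= U)%E -> (0 <= W)%E -> 0 <= c ->
  (forall a b : R, 1 < a -> 0 < b -> (a%:E < U)%E -> (b%:E < W)%E ->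
     (a - 1) * b <= c * ((m%:R * a + 1) * b + m.+1%:R * a)) ->
  (lower_bound m.+2 U W <= c%:E)%E.
Proof.
move=> U0 W0 c0 H.
have m0 : 0 <= m%:R :> R by rewrite ler0n.
have E2 : m.+2%:R - 2 = m%:R :> R by rewrite -addn2 natrD addrK.
have E1 : m.+2%:R - 1 = m.+1%:R :> R by rewrite -addn1 natrD addrK.
have n0 : 0 < m.+1%:R :> R by rewrite ltr0n.
case: U U0 H => [a||] // U0 H; case: W W0 H => [b||] // W0 H;
  rewrite /lower_bound E1 E2.
- rewrite !lee_fin in U0 W0 *.
  have den0 : 0 <= (m%:R * a + 1) * b + m.+1%:R * a.
    by rewrite addr_ge0 // mulr_ge0 // addr_ge0 // mulr_ge0.
  have [a1|a1] := leP a 1.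
    apply: le_trans c0; apply: mulr_le0_ge0; last by rewrite invr_ge0.
    by rewrite mulr_le0_ge0 // subr_le0.
  have [b0|b0] := leP b 0.
    have -> : b = 0 by apply/le_anti; rewrite b0.
    by rewrite mulr0 mul0r.
  have den1 : 0 < (m%:R * a + 1) * b + m.+1%:R * a.
    rewrite ltr_wpDl //; last by rewrite mulr_gt0 //; lra.
    by rewrite mulr_ge0 // addr_ge0 // mulr_ge0.
  rewrite ler_pdivrMr //.
  suff : (- b - c * b) + (b - c * (m%:R * b + m.+1%:R)) * a <= 0 by lra.
  apply: (affine_le0_at_end a1) => x x1 xa.
  suff : - (c * m.+1%:R * x) + ((x - 1) - c * (m%:R * x + 1)) * b <= 0 by lra.
  apply: (affine_le0_at_end b0) => y y0 yb.
  by have := H x y x1 y0; rewrite !lte_fin => /(_ xa yb); lra.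
- rewrite lee_fin in U0; rewrite invey mule0 adde0.
  have [a0|a0] := leP a 0.
    have -> : a = 0 by apply/le_anti; rewrite a0.
    by rewrite inve0 /= addey // invey mule0 lee_fin.
  rewrite inver (gt_eqF a0).
  have den : 0 < m%:R + a^-1 by rewrite ltr_wpDl // invr_gt0.
  rewrite -EFinB -EFinD inver (gt_eqF den) -EFinM lee_fin ler_pdivrMr //.
  have [a1|a1] := leP a 1.
    have : 1 <= a^-1 by rewrite invf_ge1.
    have := mulr_ge0 c0 (ltW den); lra.
  suff h : (a - 1) - c * (m%:R * a + 1) <= 0.
    have ia : a^-1 * a = 1 by rewrite mulVf ?gt_eqF.
    rewrite -(ler_pM2r a0).
    have -> : (1 - a^-1) * a = a - 1 by rewrite mulrBl ia mul1r.
    have -> : c * (m%:R + a^-1) * a = c * (m%:R * a + 1) by rewrite -mulrA mulrDl ia.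
    lra.
  suff : - (1 + c) + (1 - c * m%:R) * a <= 0 by lra.
  apply: (affine_le0_at_end a1) => x x1 xa.
  suff : (x - 1) - c * (m%:R * x + 1) <= 0 by lra.
  apply: (@affine_le0_at_infty _ (- (c * m.+1%:R * x)) _ 0) => y y0.
  by have := H x y x1 y0; rewrite lte_fin ltry => /(_ xa isT); lra.
- rewrite lee_fin in W0; rewrite invey sube0 adde0.
  have [b0|b0] := leP b 0.
    have -> : b = 0 by apply/le_anti; rewrite b0.
    by rewrite inve0 gt0_muley ?lte_fin // addey // invey mule0 lee_fin.
  rewrite inver (gt_eqF b0).
  have den : 0 < m%:R + m.+1%:R * b^-1 by rewrite ltr_wpDl // mulr_gt0 ?invr_gt0.
  rewrite -EFinM -EFinD inver (gt_eqF den) mul1e lee_fin -div1r ler_pdivrMr //.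
  suff h : - (c * m.+1%:R) + (1 - c * m%:R) * b <= 0.
    have ib : b^-1 * b = 1 by rewrite mulVf ?gt_eqF.
    rewrite -(ler_pM2r b0).
    have -> : c * (m%:R + m.+1%:R * b^-1) * b = c * (m%:R * b + m.+1%:R).
      by rewrite -mulrA mulrDl -mulrA ib mulr1.
    lra.
  apply: (affine_le0_at_end b0) => y y0 yb.
  suff : y - c * (m%:R * y + m.+1%:R) <= 0 by lra.
  apply: (@affine_le0_at_infty _ (- (y + c * y)) _ 1) => x x1.
  by have := H x y x1 y0; rewrite lte_fin ltry => /(_ isT yb); lra.
- rewrite invey mule0 sube0 !adde0.
  have h : 1 - c * m%:R <= 0.
    apply: (@affine_le0_at_infty _ (- (c * m.+1%:R)) _ 0) => y y0.
    suff : y - c * (m%:R * y + m.+1%:R) <= 0 by lra.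
    apply: (@affine_le0_at_infty _ (- (y + c * y)) _ 1) => x x1.
    by have := H x y x1 y0; rewrite !ltry => /(_ isT isT); lra.
  have m1 : 0 < m%:R :> R.
    by rewrite lt_def m0 andbT; apply/eqP => mE; move: h; rewrite mE; lra.
  rewrite inver (gt_eqF m1) mul1e lee_fin -div1r ler_pdivrMr //; lra.
Qed.

(** If W is infinite there is nothing to prove.  If W is finite, the hypothesis,
    being affine in a and in b, bounds both from above, so V and S are finite too. *)
Lemma upper_inequality_of_real (R : realType) (m : nat) (S V W : \bar R) :
  (0 < S)%E -> (0 <= V)%E -> (0 <= W)%E ->
  (forall a b c : R, 0 < a -> 0 <= c -> (a%:E < S)%E -> (b%:E < V)%E ->
     (W <= c%:E)%E -> m.+1%:R * (1 + a) <= (1 - b) * (c + 1)) ->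
  upper_inequality m.+2 S V W.
Proof.
move=> S0 V0 W0 H.
have E2 : m.+2%:R - 2 = m%:R :> R by rewrite -addn2 natrD addrK.
have E1 : m.+2%:R - 1 = m.+1%:R :> R by rewrite -addn1 natrD addrK.
have n0 : 0 < m.+1%:R :> R by rewrite ltr0n.
case: W W0 H => [c||] // W0 H; last first.
  by case: S {S0 H} => [a||]; case: V {V0} => [b||]; rewrite /upper_inequality ?leey.
rewrite lee_fin in W0.
have {}H a b : 0 < a -> (a%:E < S)%E -> (b%:E < V)%E ->
    m.+1%:R * (1 + a) <= (1 - b) * (c + 1).
  by move=> a0 aS bV; apply: H.
have [a0 [a00 a0S]] : exists a0 : R, 0 < a0 /\ (a0%:E < S)%E.
  case: S S0 H => [s||] // s0 _; last by exists 1; rewrite ltr01 ltry.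
  by exists (s / 2); move: s0; rewrite !lte_fin; lra.
case: V V0 H => [b||] // V0 H; last first.
  exfalso; have : c + 1 <= 0.
    apply: (@affine_le0_at_infty _ (m.+1%:R * (1 + a0) - (c + 1)) _ 0) => x x0.
    by have := H a0 x a00 a0S; rewrite ltry => /(_ isT); lra.
  lra.
have Hb a : 0 < a -> (a%:E < S)%E -> m.+1%:R * (1 + a) <= (1 - b) * (c + 1).
  move=> a0' aS.
  suff : (m.+1%:R * (1 + a) - (c + 1)) + (c + 1) * b <= 0 by lra.
  apply: (@affine_le0_at_end _ _ _ (b - 1)); first by lra.
  by move=> x _ xb; have := H a x a0' aS; rewrite lte_fin => /(_ xb); lra.
case: S S0 a0S H Hb => [s||] // S0 a0S H Hb; last first.
  exfalso; have : m.+1%:R <= 0 :> R.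
    apply: (@affine_le0_at_infty _ (m.+1%:R - (1 - b) * (c + 1)) _ 0) => x x0.
    by have := Hb x x0; rewrite ltry => /(_ isT); lra.
  lra.
rewrite lte_fin in S0.
rewrite /upper_inequality E1 ler_pdivlMr //.
have -> : (1 - b) * c - m.+2%:R + 2 - b = (1 - b) * (c + 1) - m.+1%:R.
  by rewrite -E1; ring.
suff : (m.+1%:R - (1 - b) * (c + 1)) + m.+1%:R * s <= 0 by lra.
apply: (affine_le0_at_end S0) => x x0 xs.
by have := Hb x x0; rewrite lte_fin => /(_ xs); lra.
Qed.

Theorem theorem1 (R : realType) (n : nat) (theta : 'rV[R]_n)
    (hn : (2 <= n)%N) (htheta : lin_indep_Q theta) :
  (lower_bound n (uomega_lin theta) (omega_lin theta) <= omega_sim theta)%E /\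
  upper_inequality n (omega_sim theta) (uomega_sim theta) (omega_lin theta).
Proof.
case: n hn theta htheta => [|[|m]] // _ theta ind.
have S0 := omega_sim_gt0 ind.
have W0 := omega_lin_ge0 theta.
split.
- case: (omega_sim theta) S0 (fun a b c => @linear_to_simul R m theta a b c ind)
    => [c||] // S0 H; last by rewrite leey.
  rewrite lte_fin in S0.
  apply: lower_bound_le => //; [exact: uomega_lin_ge0 | exact: ltW |].
  by move=> a b a1 b0 aU bW; apply: H => //; exact: ltW.
- apply: upper_inequality_of_real => //; first exact: uomega_sim_ge0.
  by move=> a b c a0 c0 aS bV cW; apply: (simul_to_linear ind a0 c0 aS bV cW).
Qed.
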